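(* Let $M$ be a $(4n+3)$-dimensional smooth manifold and let $\omega=\omega_1\boldsymbol{i}+\omega_2\boldsymbol{j}+\omega_3\boldsymbol{k}$ be a nondegenerate quaternionic $CR$ structure on an open set $U\subset M$, with almost complex structures $J_1,J_2,J_3$ on $\mathcal D=\bigcap_{\alpha=1}^3\operatorname{Null}\omega_\alpha$, and let $\bar J_\alpha$ be the extension of $J_\alpha$ to the codimension $1$ contact subbundle $\operatorname{Null}\omega_\alpha$. Then, for each $\alpha=1,2,3$, the almost complex structure $\bar J_\alpha$ is integrable on $\operatorname{Null}\omega_\alpha$; that is, if $\operatorname{Null}\omega_\alpha\otimes\mathbb C=T^{1,0}\oplus T^{0,1}$ is the decomposition into the $\pm\sqrt{-1}$-eigenbundles of $\bar J_\alpha$, then $[T^{1,0},T^{1,0}]\subset T^{1,0}$.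
   Context: Throughout, $(\alpha,\beta,\gamma)$ denotes any cyclic permutation of $(1,2,3)$, and $\operatorname{Null}\eta=\ker\eta$ for a $1$-form $\eta$, while for a $2$-form $\rho$, $\operatorname{Null}\rho=\{v:\rho(v,\cdot)=0\}$. $\operatorname{Im}\mathbb H=\mathbb R\boldsymbol i+\mathbb R\boldsymbol j+\mathbb R\boldsymbol k$. Nondegenerate quaternionic $CR$ structure on $U$: an $\operatorname{Im}\mathbb H$-valued $1$-form $\omega=\omega_1\boldsymbol i+\omega_2\boldsymbol j+\omega_3\boldsymbol k$ ($\omega_\alpha$ real $1$-forms) on $U$ such that, with $\mathcal D=\bigcap_\alpha\operatorname{Null}\omega_\alpha$ (rank $4n$) and $\sigma_\alpha=d\omega_\alpha|_{\mathcal D}$: (1) $\mathcal D$ and $[\mathcal D,\mathcal D]$ span $TU$, and $TU/\mathcal D$ is identified by $\omega$ with $\operatorname{Im}\mathbb H$; (2) each $\sigma_\alpha$ is nondegenerate on $\mathcal D$; (3) the endomorphisms $J_\gamma=\sigma_\beta^{-1}\circ\sigma_\alpha:\mathcal D\to\mathcal D$, i.e. $\sigma_\beta(J_\gamma X,Y)=\sigma_\alpha(X,Y)$ for $X,Y\in\mathcal D$, satisfy $J_\gamma^2=-1$ and $J_\alpha J_\beta=J_\gamma=-J_\beta J_\alpha$; (4) the $2$-forms $\rho_\alpha=d\omega_\alpha+2\,\omega_\beta\wedge\omega_\gamma$ satisfy $\operatorname{Null}\rho_1=\operatorname{Null}\rho_2=\operatorname{Null}\rho_3=:V$, where $V$ is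 a rank $3$ distribution complementary to $\mathcal D$. Let $\xi_1,\xi_2,\xi_3$ be the frame of $V$ with $\omega_\alpha(\xi_\beta)=\delta_{\alpha\beta}$. Then $\operatorname{Null}\omega_\alpha=\mathcal D\oplus\operatorname{span}\{\xi_\beta,\xi_\gamma\}$, and $\bar J_\alpha$ is defined on it by $\bar J_\alpha|_{\mathcal D}=J_\alpha$, $\bar J_\alpha\xi_\beta=\xi_\gamma$, $\bar J_\alpha\xi_\gamma=-\xi_\beta$. *)

(* Defs.v *)
From mathcomp Require Import all_boot all_order all_algebra.
From mathcomp Require Import all_classical all_reals all_analysis.

Set Implicit Arguments.
Unset Strict Implicit.
Unset Printing Implicit Defensive.

Import Order.TTheory GRing.Theory Num.Theory.
Import numFieldNormedType.Exports.

Local Open Scope classical_set_scope.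
Local Open Scope ring_scope.

Section Smooth.
Context {R : realType} {N : nat} {W : normedModType R}.

(* Only meant for open O: values of f outside O are then irrelevant. *)
Fixpoint Ck_on (k : nat) (O : set 'rV[R]_N) (f : 'rV[R]_N -> W) : Prop :=
  match k with
  | 0%N => forall x, O x -> {for x, continuous f}
  | k'.+1 => (forall x, O x -> differentiable f x) /\
             (forall v : 'rV[R]_N, Ck_on k' O (fun x => 'D_v f x))
  end.

Definition smooth_on (O : set 'rV[R]_N) (f : 'rV[R]_N -> W) : Prop :=
  forall k, Ck_on k O f.

End Smooth.

(* A smooth manifold given by an atlas: mfd_phi i is a homeomorphism from the
   open set mfd_dom i onto an open subset of R^N, with inverse mfd_psi i; both
   are total functions, with irrelevant values outside of these sets. *)
Record smooth_manifold (R : realType) (N : nat) := SmoothManifold {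
  mfd_space :> topologicalType ;
  mfd_hausdorff : hausdorff_space mfd_space ;
  mfd_second_countable : @second_countable mfd_space ;
  mfd_chart : Type ;
  mfd_dom : mfd_chart -> set mfd_space ;
  mfd_phi : mfd_chart -> mfd_space -> 'rV[R]_N ;
  mfd_psi : mfd_chart -> 'rV[R]_N -> mfd_space ;
  mfd_cover : forall p, exists i, mfd_dom i p ;
  mfd_dom_open : forall i, open (mfd_dom i) ;
  mfd_im_open : forall i, open (mfd_phi i @` mfd_dom i) ;
  mfd_phiK : forall i p, mfd_dom i p -> mfd_psi i (mfd_phi i p) = p ;
  mfd_phi_cont : forall i, {within mfd_dom i, continuous (mfd_phi i)} ;
  mfd_psi_cont : forall i,
    {within mfd_phi i @` mfd_dom i, continuous (mfd_psi i)} ;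
  mfd_transition : forall i j,
    smooth_on (mfd_phi i @` (mfd_dom i `&` mfd_dom j))
              (mfd_phi j \o mfd_psi i)
}.

Section TensorCalculus.
Context {R : realType} {N : nat} (M : smooth_manifold R N).

(* A tangent vector or covector at p is described by its components in every
   chart around p: X i p is the row of components in the chart i, and is
   irrelevant unless mfd_dom i p. *)
Definition components := mfd_chart M -> M -> 'rV[R]_N.

Definition endo_components := mfd_chart M -> M -> 'rV[R]_N -> 'rV[R]_N.

Definition chart_deriv {W : normedModType R} (i : mfd_chart M)
    (v : 'rV[R]_N) (f : M -> W) (p : M) : W :=
  'D_v (f \o mfd_psi i) (mfd_phi i p).

Definition transition_deriv (i j : mfd_chart M) (p : M) (v : 'rV[R]_N) :
  'rV[R]_N := chart_deriv i v (mfd_phi j) p.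

Definition pairing (w v : 'rV[R]_N) : R := (v *m w^T) 0 0.

Definition bil (B : 'M[R]_N) (u v : 'rV[R]_N) : R := (u *m B *m v^T) 0 0.

Definition smooth_components (O : set M) (X : components) : Prop :=
  forall i, smooth_on (mfd_phi i @` (O `&` mfd_dom i)) (X i \o mfd_psi i).

Definition vector_field (O : set M) (X : components) : Prop :=
  smooth_components O X /\
  forall i j p, O p -> mfd_dom i p -> mfd_dom j p ->
    X j p = transition_deriv i j p (X i p).

Definition one_form (O : set M) (w : components) : Prop :=
  smooth_components O w /\
  forall i j p, O p -> mfd_dom i p -> mfd_dom j p ->
    forall v, pairing (w i p) v = pairing (w j p) (transition_deriv i j p v).

Definition lie (X Y : components) : components := fun i p =>
  chart_deriv i (X i p) (Y i) p - chart_deriv i (Y i p) (X i) p.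

(* The 2-form with matrix B is (u, v) |-> bil B u v. The normalization is
   dw(X, Y) = X w(Y) - Y w(X) - w([X, Y]) and
   (u /\ v)(X, Y) = u(X) v(Y) - u(Y) v(X). *)
Definition ext_deriv (w : components) (i : mfd_chart M) (p : M) : 'M[R]_N :=
  \matrix_(k, l) (chart_deriv i (delta_mx 0 k) (w i) p 0 l
                  - chart_deriv i (delta_mx 0 l) (w i) p 0 k).

Definition wedge (u v : 'rV[R]_N) : 'M[R]_N := u^T *m v - v^T *m u.

(* Subspaces of the tangent space are row spaces of matrices. *)
Definition null1 (w : components) (i : mfd_chart M) (p : M) : 'M[R]_N :=
  kermx (w i p)^T.

Definition null2 (B : 'M[R]_N) : 'M[R]_N := kermx B.

(* In what follows the index set {1, 2, 3} is 'I_3 with its cyclic addition: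
   the cyclic permutations (alpha, beta, gamma) are the (a, a + 1, a + 2). *)

Definition Dbundle (w : 'I_3 -> components) (i : mfd_chart M) (p : M) :
  'M[R]_N := (\bigcap_(a < 3) null1 (w a) i p)%MS.

Definition rho (w : 'I_3 -> components) (a : 'I_3) (i : mfd_chart M) (p : M) :
    'M[R]_N :=
  ext_deriv (w a) i p + 2 *: wedge (w (a + 1) i p) (w (a + 2) i p).

Definition Dsection (w : 'I_3 -> components) (O : set M) (X : components) :=
  vector_field O X /\
  forall i p, O p -> mfd_dom i p -> (X i p <= Dbundle w i p)%MS.

End TensorCalculus.

Section QuaternionicCR.
Context {R : realType} {n : nat} (M : smooth_manifold R (4 * n + 3)%N).
Implicit Types (U O : set M) (w xi : 'I_3 -> components M).
Implicit Types (J Jbar : 'I_3 -> endo_components M).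

(* J is determined on the distribution by w through qCR_J; its values outside
   of the distribution are irrelevant. Since sigma_(a+1) is nondegenerate,
   qCR_J also makes J linear on the distribution. *)
Record nondegenerate_qCR U w J : Prop := NondegenerateQCR {
  qCR_form : forall a, one_form U (w a) ;
  qCR_rankD : forall i p, U p -> mfd_dom i p ->
    \rank (Dbundle w i p) = (4 * n)%N ;
  (* By finite dimension, finitely many brackets suffice at a given point. *)
  qCR_span : forall i p, U p -> mfd_dom i p ->
    exists (O : set M) (m : nat) (X Y : 'I_m -> components M),
      [/\ open O, O `<=` U, O p,
          forall k, Dsection w O (X k) /\ Dsection w O (Y k) &
          row_full (Dbundle w i p +
                    \sum_(k < m) <<lie (X k) (Y k) i p>>)%MS] ;
  (* w is onto Im H; hence it induces an isomorphism from TU / D. *)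
  qCR_quotient : forall i p, U p -> mfd_dom i p ->
    forall h : 'I_3 -> R, exists v, forall a, pairing (w a i p) v = h a ;
  qCR_sigma_nondegenerate : forall i p, U p -> mfd_dom i p ->
    forall a X, (X <= Dbundle w i p)%MS ->
      (forall Y, (Y <= Dbundle w i p)%MS ->
         bil (ext_deriv (w a) i p) X Y = 0) -> X = 0 ;
  qCR_J : forall i p, U p -> mfd_dom i p ->
    forall a X, (X <= Dbundle w i p)%MS ->
      (J (a + 2)%R i p X <= Dbundle w i p)%MS /\
      forall Y, (Y <= Dbundle w i p)%MS ->
        bil (ext_deriv (w (a + 1)) i p) (J (a + 2) i p X) Y =
        bil (ext_deriv (w a) i p) X Y ;
  qCR_J_sqr : forall i p, U p -> mfd_dom i p ->
    forall a X, (X <= Dbundle w i p)%MS -> J a i p (J a i p X) = - X ;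
  qCR_J_mul : forall i p, U p -> mfd_dom i p ->
    forall a X, (X <= Dbundle w i p)%MS ->
      J a i p (J (a + 1) i p X) = J (a + 2) i p X /\
      J (a + 2) i p X = - J (a + 1) i p (J a i p X) ;
  qCR_null_rho : forall i p, U p -> mfd_dom i p ->
    forall a b, (null2 (rho w a i p) :=: null2 (rho w b i p))%MS ;
  qCR_rankV : forall i p, U p -> mfd_dom i p ->
    forall a, \rank (null2 (rho w a i p)) = 3%N ;
  qCR_complementary : forall i p, U p -> mfd_dom i p ->
    forall a, row_full (Dbundle w i p + null2 (rho w a i p))%MS /\
      (Dbundle w i p :&: null2 (rho w a i p))%MS = 0
}.

Definition dual_frame U w xi : Prop :=
  forall i p, U p -> mfd_dom i p ->
    (forall a b, (xi a i p <= null2 (rho w b i p))%MS) /\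
    (forall a b, pairing (w a i p) (xi b i p) = (a == b)%:R).

Definition extends_J U w J xi Jbar : Prop :=
  forall i p, U p -> mfd_dom i p -> forall a,
    [/\ forall (c : R) u v, (u <= null1 (w a) i p)%MS ->
          (v <= null1 (w a) i p)%MS ->
          Jbar a i p (c *: u + v) = c *: Jbar a i p u + Jbar a i p v,
        forall X, (X <= Dbundle w i p)%MS -> Jbar a i p X = J a i p X,
        Jbar a i p (xi (a + 1) i p) = xi (a + 2) i p &
        Jbar a i p (xi (a + 2) i p) = - xi (a + 1) i p].

(* Complexified tangent vectors u + sqrt(-1) v are the pairs (u, v), and
   complex vector fields are pairs of real ones. *)
Definition cvec := ('rV[R]_(4 * n + 3) * 'rV[R]_(4 * n + 3))%type.

Definition cmuli (z : cvec) : cvec := (- z.2, z.1).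

Definition ccomponents := (components M * components M)%type.

Definition cval (Z : ccomponents) (i : mfd_chart M) (p : M) : cvec :=
  (Z.1 i p, Z.2 i p).

Definition clie (Z T : ccomponents) : ccomponents :=
  ((fun i p => lie Z.1 T.1 i p - lie Z.2 T.2 i p),
   (fun i p => lie Z.1 T.2 i p + lie Z.2 T.1 i p)).

Definition T10 w Jbar (a : 'I_3) (i : mfd_chart M) (p : M) (z : cvec) : Prop :=
  [/\ (z.1 <= null1 (w a) i p)%MS, (z.2 <= null1 (w a) i p)%MS &
      (Jbar a i p z.1, Jbar a i p z.2) = cmuli z].

Definition T10_section w Jbar (a : 'I_3) O (Z : ccomponents) : Prop :=
  [/\ vector_field O Z.1, vector_field O Z.2 &
      forall i p, O p -> mfd_dom i p -> T10 w Jbar a i p (cval Z i p)].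

Definition integrable_CR U w Jbar (a : 'I_3) : Prop :=
  forall O (Z T : ccomponents), open O -> O `<=` U ->
    T10_section w Jbar a O Z -> T10_section w Jbar a O T ->
    forall i p, O p -> mfd_dom i p -> T10 w Jbar a i p (cval (clie Z T) i p).

End QuaternionicCR.

(* Main.v *)
(* Write (a, b, c) for the cyclic permutation starting at a, theta for
   w_b - i w_c and P for rho_b - i rho_c = d theta + 2i theta /\ w_a. A complex
   vector z is in T^{1,0} iff it is a null vector of w_a, theta and P, and the
   bracket of two such fields z, t is again one:
   - d w_a (z, t) = 0, since Ja is skew for d w_a on D, hence w_a([z, t]) = 0;
   - d theta (z, t) = P(z, t) = 0, hence theta([z, t]) = 0;
   - the contraction of P by [z, t] is that of -dP by z and t, and
     dP = 2i (P /\ w_a - theta /\ d w_a) is killed by z and t. *)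
Require Import Defs.
From mathcomp Require Import all_boot all_order all_algebra.
From mathcomp Require Import all_classical all_reals all_analysis.
From mathcomp Require Import ring.
Import Order.TTheory GRing.Theory Num.Theory.
Import numFieldNormedType.Exports.
Local Open Scope classical_set_scope.
Local Open Scope ring_scope.

(** [J] and [Jbar] are pointwise data with no smoothness assumed, so the eigenvector equation itself
    cannot be differentiated. The null-vector description involves only [w] and its first
    derivatives, which are smooth. Its converse half, from null vector to eigenvector, rests on the
    nondegeneracy of dw_c on the distribution. The contraction identity is the Cartan formula for
    dP(z, t, v): since P(z, .) and P(t, .) vanish identically, only -P([z, t], v) survives. It is
    proved with v constant in a chart, where dP is a cyclic sum of derivatives of coefficients; the
    second derivatives of [w] cancel in that sum by Schwarz's theorem. In the formula for dP, d
    theta may be replaced by P because theta /\ w_a /\ w_a = 0. All computations are real: each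
    complex equation is split into its real and imaginary parts, and contractions of P are tested on
    real vectors only, which suffices by complex linearity. *)

(** * Pairings, bilinear forms and wedge products in coordinates *)

Section BilinearAlgebra.
Context {R : realType} {N : nat}.
Implicit Types (u v x y : 'rV[R]_N) (B C : 'M[R]_N) (c : R).

Lemma pairingE u v : pairing u v = \sum_k v 0 k * u 0 k.
Proof. by rewrite /pairing mxE; apply: eq_bigr => k _; rewrite mxE. Qed.

Lemma pairingC u v : pairing u v = pairing v u.
Proof. by rewrite !pairingE; apply: eq_bigr => k _; rewrite mulrC. Qed.

Lemma pairingDr u x y : pairing u (x + y) = pairing u x + pairing u y.
Proof. by rewrite /pairing mulmxDl mxE. Qed.

Lemma pairingZr u c x : pairing u (c *: x) = c * pairing u x.
Proof. by rewrite /pairing -scalemxAl mxE. Qed.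

Lemma pairingNr u x : pairing u (- x) = - pairing u x.
Proof. by rewrite /pairing mulNmx mxE. Qed.

Lemma bilE B u v : bil B u v = \sum_k \sum_l u 0 k * B k l * v 0 l.
Proof.
rewrite /bil mxE exchange_big; apply: eq_bigr => l _.
by rewrite !mxE mulr_suml.
Qed.

Lemma bilDl B x y v : bil B (x + y) v = bil B x v + bil B y v.
Proof. by rewrite /bil !mulmxDl mxE. Qed.

Lemma bilZl B c x v : bil B (c *: x) v = c * bil B x v.
Proof. by rewrite /bil -!scalemxAl mxE. Qed.

Lemma bilDm B C u v : bil (B + C) u v = bil B u v + bil C u v.
Proof. by rewrite /bil mulmxDr mulmxDl mxE. Qed.

Lemma bilZm c B u v : bil (c *: B) u v = c * bil B u v.
Proof. by rewrite /bil -scalemxAr -scalemxAl mxE. Qed.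

Lemma bil_tr B u v : bil B u v = bil B^T v u.
Proof.
rewrite !bilE exchange_big; apply: eq_bigr => k _; apply: eq_bigr => l _.
by rewrite mxE mulrC mulrA [in RHS]mulrAC.
Qed.

Lemma bil_skew B u v : B^T = - B -> bil B u v = - bil B v u.
Proof. by move=> hB; rewrite bil_tr hB /bil mulmxN mulNmx mxE. Qed.

Lemma bil_null2 B u v : (u <= null2 B)%MS -> bil B u v = 0.
Proof. by move=> /sub_kermxP h; rewrite /bil h mul0mx mxE. Qed.

Lemma pairing_sum {I : finType} u (F : I -> 'rV[R]_N) :
  pairing u (\sum_k F k) = \sum_k pairing u (F k).
Proof. by rewrite /pairing mulmx_suml summxE. Qed.

Lemma wedgeE u v x y :
  bil (wedge u v) x y = pairing u x * pairing v y - pairing v x * pairing u y.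
Proof.
have bil_outer a b : bil (a^T *m b) x y = pairing a x * pairing b y.
  rewrite /bil mulmxA -mulmxA mxE big_ord1 -/(pairing a x); congr (_ * _).
  by rewrite pairingC.
by rewrite /wedge bilDm -scaleN1r bilZm !bil_outer mulN1r.
Qed.

Lemma trmx_wedge u v : (wedge u v)^T = - wedge u v.
Proof. by rewrite /wedge linearB /= !trmx_mul !trmxK opprB. Qed.

End BilinearAlgebra.

(** * The 2-forms [rho] and the distribution, evaluated on vectors *)

Section Forms.
Context {R : realType} {N : nat} (M : smooth_manifold R N).
Implicit Types (w : 'I_3 -> components M) (i : mfd_chart M) (p : M).
Implicit Types (u v : 'rV[R]_N).

Lemma trmx_ext_deriv (w : components M) i p :
  (ext_deriv w i p)^T = - ext_deriv w i p.
Proof. by apply/matrixP => k l; rewrite !mxE opprB. Qed.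

Lemma trmx_rho w a i p : (rho w a i p)^T = - rho w a i p.
Proof.
by rewrite /rho linearD linearZ /= trmx_ext_deriv trmx_wedge scalerN opprD.
Qed.

Lemma bil_rho w a i p u v : bil (rho w a i p) u v =
  bil (ext_deriv (w a) i p) u v +
  2 * (pairing (w (a + 1) i p) u * pairing (w (a + 2) i p) v -
       pairing (w (a + 2) i p) u * pairing (w (a + 1) i p) v).
Proof. by rewrite /rho bilDm bilZm wedgeE. Qed.

Lemma null1P (w : components M) i p u :
  reflect (pairing (w i p) u = 0) (u <= null1 w i p)%MS.
Proof.
apply: (iffP (sub_kermxP)) => [|h].
  by rewrite /pairing => ->; rewrite mxE.
by apply/matrixP => j k; rewrite !ord1 [LHS]h mxE.
Qed.

Lemma DbundleP w i p u :
  (u <= Dbundle w i p)%MS <-> forall a, pairing (w a i p) u = 0.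
Proof.
split=> [/sub_bigcapmxP h a|h]; first by apply/null1P/h.
by apply/sub_bigcapmxP => a _; apply/null1P.
Qed.

End Forms.

(** * Cyclic arithmetic of the three indices *)

Lemma ord3_add12 (a : 'I_3) : a + 1 + 2 = a.
Proof. by apply/val_inj; case: a => -[|[|[|]]]. Qed.

Lemma ord3_add21 (a : 'I_3) : a + 2 + 1 = a.
Proof. by apply/val_inj; case: a => -[|[|[|]]]. Qed.

Lemma ord3_add11 (a : 'I_3) : a + 1 + 1 = a + 2.
Proof. by apply/val_inj; case: a => -[|[|[|]]]. Qed.

Lemma ord3_add22 (a : 'I_3) : a + 2 + 2 = a + 1.
Proof. by apply/val_inj; case: a => -[|[|[|]]]. Qed.

Lemma ord3_uniq (a : 'I_3) : uniq [:: a; a + 1; a + 2].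
Proof. by case: a => -[|[|[|]]]. Qed.

Lemma ord3_case (a b : 'I_3) : [\/ b = a, b = a + 1 | b = a + 2].
Proof.
have : b \in [:: a; a + 1; a + 2] by case: a b => -[|[|[|//]]] ? [] [|[|[|//]]].
by rewrite !inE => /or3P[] /eqP; [constructor 1|constructor 2|constructor 3].
Qed.

(** Composing [Sa] with [Jb] or [Jc] gives [Sc] or [- Sb], again skew, so [Jb] and [Jc] are
    self-adjoint for [Sa]. The adjoint of [Ja = Jb Jc] is then [Jc Jb = - Ja], which is why both
    factorizations of [Ja] enter. *)
Lemma quaternionic_skew {R : pzRingType} {L : zmodType} (D : L -> Prop)
    (Sa Sb Sc : L -> L -> R) (Ja Jb Jc : L -> L) :
  (forall u v, Sa u v = - Sa v u) -> (forall u v, Sb u v = - Sb v u) ->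
  (forall u v, Sc u v = - Sc v u) ->
  (forall u v, Sa (- u) v = - Sa u v) -> (forall u v, Sb (- u) v = - Sb u v) ->
  (forall u, D u -> D (Jb u)) -> (forall u, D u -> D (Jc u)) ->
  (forall u v, D u -> D v -> Sa (Jb u) v = Sc u v) ->
  (forall u v, D u -> D v -> Sb (Jc u) v = Sa u v) ->
  (forall u, D u -> Jc (Jc u) = - u) ->
  (forall u, D u -> Ja u = Jb (Jc u)) ->
  (forall u, D u -> Ja u = - Jc (Jb u)) ->
  forall u v, D u -> D v -> Sa (Ja u) v = - Sa u (Ja v).
Proof.
move=> skewa skewb skewc SaN SbN Db Dc SaJb SbJc Jc2 JaE JaE' u v Du Dv.
have adjb x y : D x -> D y -> Sa (Jb x) y = Sa x (Jb y).
  by move=> Dx Dy; rewrite SaJb// [RHS]skewa SaJb// skewc.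
have SaJc x y : D x -> D y -> Sa (Jc x) y = - Sb x y.
  by move=> Dx Dy; rewrite -SbJc ?Jc2 ?SbN//; exact: Dc.
have adjc x y : D x -> D y -> Sa (Jc x) y = Sa x (Jc y).
  by move=> Dx Dy; rewrite SaJc// [RHS]skewa SaJc// opprK skewb opprK.
rewrite JaE// JaE'// [in RHS]skewa opprK SaN -skewa.
by rewrite adjb ?adjc//; [exact: Db | exact: Dc].
Qed.

(** * Eigenvectors of the extended complex structure, as linear algebra at one point *)

Section QuaternionicHermitian.
Context {K : comPzRingType} {L : lmodType K} {I : eqType}.
Variables (om : I -> L -> K) (P : I -> L -> L -> K) (xi : I -> L).
Variables (J : I -> L -> L) (Jbar : L -> L) (a b c : I).
Let D u := forall d, om d u = 0.
Hypothesis abc_cover : forall d, [\/ d = a, d = b | d = c].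
Hypothesis abc_uniq : uniq [:: a; b; c].
Hypothesis om_linear : forall d k x y, om d (k *: x + y) = k * om d x + om d y.
Hypothesis P_linear :
  forall d k x y v, P d (k *: x + y) v = k * P d x v + P d y v.
Hypothesis P_skew : forall d u v, P d u v = - P d v u.
Hypothesis om_xi : forall d e, om d (xi e) = (d == e)%:R.
Hypothesis P_xi : forall d e v, P d (xi e) v = 0.
Hypothesis J_D : forall d u, D u -> D (J d u).
Hypothesis J_sqr : forall d u, D u -> J d (J d u) = - u.
Hypothesis J_mul :
  forall u, D u -> J a u = J b (J c u) /\ J a u = - J c (J b u).
Hypothesis P_cJa : forall u v, D u -> D v -> P c (J a u) v = P b u v.
Hypothesis P_aJb : forall u v, D u -> D v -> P a (J b u) v = P c u v.
Hypothesis P_bJc : forall u v, D u -> D v -> P b (J c u) v = P a u v.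
Hypothesis P_nondegenerate :
  forall u, D u -> (forall v, D v -> P c u v = 0) -> u = 0.
Hypothesis Jbar_linear : forall k u v, om a u = 0 -> om a v = 0 ->
  Jbar (k *: u + v) = k *: Jbar u + Jbar v.
Hypothesis Jbar_D : forall u, D u -> Jbar u = J a u.
Hypotheses (Jbar_xib : Jbar (xi b) = xi c) (Jbar_xic : Jbar (xi c) = - xi b).

Let abc_neq : [/\ (a == b) = false, (a == c) = false & (b == c) = false].
Proof.
move: abc_uniq; rewrite /= !inE negb_or -andbA andbT.
by case/and3P => /negPf-> /negPf-> /negPf->.
Qed.

Let om0 d : om d 0 = 0.
Proof.
by have := om_linear d (-1) 0 0; rewrite scaler0 addr0 mulN1r addNr.
Qed.

Let omN d u : om d (- u) = - om d u.
Proof.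
by have := om_linear d (-1) u 0; rewrite om0 scaleN1r mulN1r !addr0.
Qed.

Let omD d u v : om d (u + v) = om d u + om d v.
Proof. by rewrite -[u in LHS]scale1r om_linear mul1r. Qed.

Let omZ d k u : om d (k *: u) = k * om d u.
Proof. by rewrite -[_ *: _]addr0 om_linear om0 addr0. Qed.

Let P0 d v : P d 0 v = 0.
Proof.
by have := P_linear d (-1) 0 0 v; rewrite scaler0 addr0 mulN1r addNr.
Qed.

Let PN d u v : P d (- u) v = - P d u v.
Proof.
by have := P_linear d (-1) u 0 v; rewrite P0 scaleN1r mulN1r !addr0.
Qed.

Let PNr d u v : P d u (- v) = - P d u v.
Proof. by rewrite P_skew PN -P_skew. Qed.

Let PD d x y v : P d (x + y) v = P d x v + P d y v.
Proof. by rewrite -[x in LHS]scale1r P_linear mul1r. Qed.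

Let PZ d k u v : P d (k *: u) v = k * P d u v.
Proof. by rewrite -[_ *: _]addr0 P_linear P0 addr0. Qed.

Let DN u : D u -> D (- u).
Proof. by move=> Du d; rewrite omN Du oppr0. Qed.

Let P_bJa u v : D u -> D v -> P b (J a u) v = - P c u v.
Proof.
by move=> Du Dv; rewrite -P_cJa ?J_sqr ?PN//; exact: J_D.
Qed.

Let Jbar0 : Jbar 0 = 0.
Proof.
have := Jbar_linear (-1) 0 0 (om0 a) (om0 a).
by rewrite scaler0 addr0 scaleN1r addNr.
Qed.

(** The linearity of [J a] is borrowed from [Jbar], which agrees with it on [D]. *)
Let JN u : D u -> J a (- u) = - J a u.
Proof.
move=> Du; rewrite -!Jbar_D//; last exact: DN.
have := Jbar_linear (-1) u 0 (Du a) (om0 a).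
by rewrite Jbar0 !addr0 !scaleN1r.
Qed.

(** Projection onto [D] along the frame [xi]. As each [P d] is degenerate along [xi], it sees only
    this part of its arguments, so the relations between the forms on [D] extend to all vectors. *)
Let dpart u := u - (om a u *: xi a + om b u *: xi b + om c u *: xi c).

Let dpart_D u : D (dpart u).
Proof.
have [ab ac bc] := abc_neq.
move=> d; rewrite omD omN !omD !omZ !om_xi.
have [->|->|->] := abc_cover d;
  rewrite ?eqxx ?[b == a]eq_sym ?[c == a]eq_sym ?[c == b]eq_sym ?ab ?ac ?bc;
  by rewrite !mulr0 mulr1 ?addr0 ?add0r subrr.
Qed.

Let P_dpartl d u v : P d (dpart u) v = P d u v.
Proof.
by rewrite PD PN !PD !PZ !P_xi !mulr0 !addr0 subr0.
Qed.

Let P_dpart d u v : P d u v = P d (dpart u) (dpart v).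
Proof. by rewrite P_dpartl [RHS]P_skew P_dpartl -P_skew. Qed.

Let dpart_id u : D u -> dpart u = u.
Proof. by move=> Du; rewrite /dpart !Du !scale0r !addr0 subr0. Qed.

Let dpart_split u : om a u = 0 ->
  u = om b u *: xi b + (om c u *: xi c + dpart u).
Proof.
by move=> hu; rewrite /dpart hu scale0r add0r addrA addrC subrK.
Qed.

Let JbarE u : om a u = 0 ->
  Jbar u = om b u *: xi c + (- om c u *: xi b + J a (dpart u)).
Proof.
move=> hu; have [ab ac bc] := abc_neq.
have xib : om a (xi b) = 0 by rewrite om_xi ab.
have xic : om a (xi c) = 0 by rewrite om_xi ac.
have oma_dpart : om a (dpart u) = 0 by exact: dpart_D.
rewrite {1}(dpart_split u hu) Jbar_linear ?Jbar_linear//; last first.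
  by rewrite om_linear xic oma_dpart mulr0 addr0.
by rewrite Jbar_xib Jbar_xic Jbar_D ?scalerN ?scaleNr//; exact: dpart_D.
Qed.

(** Uniqueness of the decomposition along [xi b], [xi c] and [D]; it allows the components of an
    eigenvector equation to be compared. *)
Let dpart_comb r s u : D u -> let v := r *: xi c + (s *: xi b + u) in
  [/\ om b v = s, om c v = r & dpart v = u].
Proof.
move=> Du v; have [ab ac bc] := abc_neq.
have va : om a v = 0 by rewrite !om_linear Du !om_xi ab ac !mulr0 !addr0.
have vb : om b v = s.
  by rewrite !om_linear Du !om_xi bc eqxx mulr0 mulr1 add0r addr0.
have vc : om c v = r.
  by rewrite !om_linear Du !om_xi [c == b]eq_sym bc eqxx mulr0 mulr1 !addr0.
split=> //; have := dpart_split v va.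
by rewrite vb vc {1}/v addrCA => /addrI /addrI.
Qed.

Let dpart_eigen u v : om a u = 0 -> Jbar u = - v ->
  [/\ om b v = om c u, om c v = - om b u & dpart v = - J a (dpart u)].
Proof.
move=> hu hJu.
have -> : v = - om b u *: xi c + (om c u *: xi b - J a (dpart u)).
  by rewrite -[LHS]opprK -hJu JbarE// !opprD -!scaleNr opprK.
by apply: dpart_comb; apply/DN/J_D/dpart_D.
Qed.

(* u + i v is an i-eigenvector of Jbar iff it is a null vector of om a,
   of om b - i om c and of P b - i P c. *)
Lemma eigen_null u v :
  [/\ om a u = 0, om a v = 0 & (Jbar u, Jbar v) = (- v, u)] <->
  [/\ om a u = 0, om a v = 0, om b u = - om c v & om b v = om c u] /\
  forall y, P b u y + P c v y = 0 /\ P b v y - P c u y = 0.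
Proof.
split=> [[hu hv [hJu _]]|[[hu hv h1 h2] h]].
  have [vb vc dv] := dpart_eigen u v hu hJu.
  split; first by rewrite vb vc opprK.
  move=> y; have [Du Dy] := (dpart_D u, dpart_D y).
  rewrite [P b u _]P_dpart [P c v _]P_dpart [P b v _]P_dpart [P c u _]P_dpart.
  by rewrite dv !PN P_cJa// P_bJa// opprK !subrr.
(* On [D], [P b] is [P c] precomposed with [J a], so the equation [P b u y + P c v y = 0] says that
   [P c] kills [J a (dpart u) + dpart v]; nondegeneracy concludes. *)
have hJ : J a (dpart u) = - dpart v.
  apply/eqP; rewrite -addr_eq0; apply/eqP; apply: P_nondegenerate => [d|y Dy].
    by rewrite omD J_D ?dpart_D ?addr0//; exact: dpart_D.
  have [+ _] := h y; rewrite P_dpart [P c _ _]P_dpart (dpart_id y Dy) => <-.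
  by rewrite PD P_cJa//; exact: dpart_D.
have hJ' : J a (dpart v) = dpart u.
  rewrite -[dpart v]opprK -hJ JN; last exact/J_D/dpart_D.
  by rewrite J_sqr ?opprK//; exact: dpart_D.
split=> //; rewrite !JbarE// hJ hJ'; congr pair.
  by rewrite [in RHS](dpart_split v hv) !opprD -!scaleNr h1 h2 addrCA.
by rewrite [in RHS](dpart_split u hu) h1 h2 addrCA.
Qed.

Let P_Ja_skew u v : D u -> D v -> P a (J a u) v = - P a u (J a v).
Proof.
apply: (quaternionic_skew D (P a) (P b) (P c) (J a) (J b) (J c)) => // x Dx.
- exact: J_D.
- exact: J_D.
- exact: J_sqr.
- by have [] := J_mul x Dx.
- by have [] := J_mul x Dx.
Qed.

(** Real and imaginary parts of P_a(z, t) = 0 for the eigenvectors z = u + iv and t = x + iy.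
    Skewness gives i P_a(z, t) = P_a(Jz, t) = - P_a(z, Jt) = - i P_a(z, t). *)
Lemma levi_eigen u v x y : om a u = 0 -> Jbar u = - v ->
  om a x = 0 -> Jbar x = - y -> P a u x = P a v y /\ P a u y = - P a v x.
Proof.
move=> hu hJu hx hJx; have [_ _ dv] := dpart_eigen u v hu hJu.
have [_ _ dy] := dpart_eigen x y hx hJx.
have [Du Dx] := (dpart_D u, dpart_D x).
rewrite [P a u x]P_dpart [P a v y]P_dpart [P a u y]P_dpart [P a v x]P_dpart.
rewrite dv dy !PN !PNr P_Ja_skew//; last exact: J_D.
by rewrite J_sqr// P_Ja_skew// !PNr !opprK.
Qed.

End QuaternionicHermitian.

(** * The quaternionic CR structure at a point, as an instance of this linear algebra *)

Section Pointwise.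
Context {R : realType} {n : nat} {M : smooth_manifold R (4 * n + 3)%N}.
Context {U : set M} {w : 'I_3 -> components M} {J : 'I_3 -> endo_components M}.
Context {xi : 'I_3 -> components M} {Jbar : 'I_3 -> endo_components M}.
Hypotheses (hw : nondegenerate_qCR U w J) (hxi : dual_frame U w xi).
Hypothesis hJbar : extends_J U w J xi Jbar.
Context {i : mfd_chart M} {p : M}.
Hypotheses (Up : U p) (ip : mfd_dom i p).
Implicit Types (a d : 'I_3) (u v : 'rV[R]_(4 * n + 3)).

Local Notation om d := (pairing (w d i p)).
Local Notation sigma d := (bil (ext_deriv (w d) i p)).
Local Notation P d := (bil (rho w d i p)).

Let D u := forall d, om d u = 0.

Let om_linear d k u v : om d (k *: u + v) = k * om d u + om d v.
Proof. by rewrite pairingDr pairingZr. Qed.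

Let P_linear d k x y v : P d (k *: x + y) v = k * P d x v + P d y v.
Proof. by rewrite bilDl bilZl. Qed.

Let P_skew d u v : P d u v = - P d v u.
Proof. exact/bil_skew/trmx_rho. Qed.

Let om_xi d d' : om d (xi d' i p) = (d == d')%:R.
Proof. by have [_ h] := hxi i p Up ip; apply: h. Qed.

Let P_xi d d' v : P d (xi d' i p) v = 0.
Proof. by have [h _] := hxi i p Up ip; apply: bil_null2. Qed.

Let P_D d u v : D u -> D v -> P d u v = sigma d u v.
Proof.
move=> Du Dv; rewrite bil_rho !Dv.
by rewrite !mulr0 subrr mulr0 addr0.
Qed.

Let J_D d u : D u -> D (J d i p u).
Proof.
move=> /DbundleP Du; apply/DbundleP.
by have [+ _] := qCR_J hw Up ip (d + 1) Du; rewrite ord3_add12.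
Qed.

Let P_J d u v : D u -> D v -> P (d + 1) (J (d + 2) i p u) v = P d u v.
Proof.
move=> Du Dv; rewrite (P_D _ _ _ Du Dv) (P_D _ _ _ (J_D _ _ Du) Dv).
move: Du Dv => /DbundleP Du /DbundleP Dv.
by have [_ h] := qCR_J hw Up ip d Du; apply: h.
Qed.

Let P_nondegenerate d u :
  D u -> (forall v, D v -> P d u v = 0) -> u = 0.
Proof.
move=> Du h; have /DbundleP Du' := Du.
apply: (qCR_sigma_nondegenerate hw Up ip (a := d) Du') => v /DbundleP Dv.
by rewrite -(P_D _ _ _ Du Dv) h.
Qed.

Let J_sqr d u : D u -> J d i p (J d i p u) = - u.
Proof. by move=> /DbundleP; apply: qCR_J_sqr hw i p Up ip d u. Qed.

Let J_mul a u : D u ->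
  J a i p u = J (a + 1) i p (J (a + 2) i p u) /\
  J a i p u = - J (a + 2) i p (J (a + 1) i p u).
Proof.
move=> /DbundleP Du; have [] := qCR_J_mul hw Up ip (a + 1) Du.
by rewrite ord3_add11 ord3_add12 => -> h2; split.
Qed.

Let P_cJa a u v : D u -> D v -> P (a + 2) (J a i p u) v = P (a + 1) u v.
Proof. by have := P_J (a + 1) u v; rewrite ord3_add11 ord3_add12. Qed.

Let P_aJb a u v : D u -> D v -> P a (J (a + 1) i p u) v = P (a + 2) u v.
Proof. by have := P_J (a + 2) u v; rewrite ord3_add21 ord3_add22. Qed.

Let Jbar_linear a k u v : om a u = 0 -> om a v = 0 ->
  Jbar a i p (k *: u + v) = k *: Jbar a i p u + Jbar a i p v.
Proof.
move=> /null1P hu /null1P hv.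
by have [lin _ _ _] := hJbar i p Up ip a; apply: lin.
Qed.

Let Jbar_D a u : D u -> Jbar a i p u = J a i p u.
Proof.
by move=> /DbundleP Du; have [_ ext _ _] := hJbar i p Up ip a; apply: ext.
Qed.

Lemma T10P a (z : cvec) : T10 w Jbar a i p z <->
  [/\ om a z.1 = 0, om a z.2 = 0, om (a + 1) z.1 = - om (a + 2) z.2 &
      om (a + 1) z.2 = om (a + 2) z.1] /\
  forall v, P (a + 1) z.1 v + P (a + 2) z.2 v = 0 /\
            P (a + 1) z.2 v - P (a + 2) z.1 v = 0.
Proof.
have [_ _ xi1 xi2] := hJbar i p Up ip a.
have eig := eigen_null (fun d => om d) (fun d => P d) (fun d => xi d i p)
  (fun d => J d i p) (Jbar a i p) a (a + 1) (a + 2) (ord3_case a) (ord3_uniq a)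
  om_linear P_linear P_skew om_xi P_xi J_D J_sqr (P_cJa a)
  (P_nondegenerate (a + 2)) (Jbar_linear a) (Jbar_D a) xi1 xi2 z.1 z.2.
apply: iff_trans eig; split=> -[hu hv hJ]; (split; last exact: hJ).
- exact/null1P.
- exact/null1P.
- exact/null1P.
- exact/null1P.
Qed.

Lemma sigma_T10 a (z t : cvec) : T10 w Jbar a i p z -> T10 w Jbar a i p t ->
  sigma a z.1 t.1 = sigma a z.2 t.2 /\ sigma a z.1 t.2 = - sigma a z.2 t.1.
Proof.
move=> hz ht; have [[_ _ z1 z2] _] := (T10P a z).1 hz.
have [[_ _ t1 t2] _] := (T10P a t).1 ht.
have [/null1P hu _ [hJu _]] := hz; have [/null1P hx _ [hJx _]] := ht.
have [_ _ xi1 xi2] := hJbar i p Up ip a.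
have [] := levi_eigen (fun d => om d) (fun d => P d) (fun d => xi d i p)
  (fun d => J d i p) (Jbar a i p) a (a + 1) (a + 2) (ord3_case a) (ord3_uniq a)
  om_linear P_linear P_skew om_xi P_xi J_D J_sqr (J_mul a)
  (P_aJb a) (P_J a) (Jbar_linear a) (Jbar_D a) xi1 xi2 _ _ _ _ hu hJu hx hJx.
(* [P a] and [sigma a] differ by a multiple of w_b /\ w_c, which is proportional to theta /\
   conj(theta) and so vanishes on two vectors killed by theta. *)
have sE u v : P a u v - 2 * (om (a + 1) u * om (a + 2) v -
    om (a + 2) u * om (a + 1) v) = sigma a u v by rewrite bil_rho addrK.
rewrite -!sE z1 z2 t1 t2 => -> ->; split; ring.
Qed.

End Pointwise.

(** * Symmetry of mixed directional derivatives *)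

Section Schwarz.
Context {R : realType} {V : normedModType R}.
Implicit Types (f : V -> R) (u v x : V).

Lemma is_derive_line f x u (s : R) : derivable f (x + s *: u) u ->
  is_derive s 1 (fun r => f (x + r *: u)) ('D_u f (x + s *: u)).
Proof.
have E : (fun h : R => h^-1 *: (((fun r => f (x + r *: u)) \o shift s) (h *: 1)
    - f (x + s *: u))) =
  (fun h => h^-1 *: ((f \o shift (x + s *: u)) (h *: u) - f (x + s *: u))).
  apply/funext => h /=; congr (_ *: (f _ - _)).
  by rewrite [h *: 1]mulr1 scalerDl addrCA addrA.
by move=> df; split; rewrite /derivable /derive E.
Qed.

Lemma derivable_MVT f x u (h : R) : 0 <= h ->
  (forall s, 0 <= s <= h -> derivable f (x + s *: u) u) ->
  exists2 s, 0 <= s <= h & f (x + h *: u) - f x = h * 'D_u f (x + s *: u).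
Proof.
move=> h0 df.
have [||s] := @MVT_segment R (fun r => f (x + r *: u))
  (fun r => 'D_u f (x + r *: u)) 0 h h0.
- move=> s; rewrite in_itv /= => /andP[s0 sh]; apply: is_derive_line.
  by apply: df; rewrite !ltW.
- apply: derivable_within_continuous => s; rewrite in_itv /= => hs.
  by have [] := is_derive_line f x u s (df s hs).
- rewrite in_itv /= => hs; rewrite scale0r addr0 subr0 => ->.
  by exists s => //; rewrite mulrC.
Qed.

(** The mean value theorem is applied along [u] to the increment of [f] in the direction [v], then
    along [v] to ['D_u f]. The left side is symmetric in [u] and [v], so exchanging them reaches the
    other mixed derivative. *)
Lemma second_difference f x u v (h : R) : 0 <= h ->
  (forall s t, 0 <= s <= h -> 0 <= t <= h ->
    let y := x + s *: u + t *: v in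
    derivable f y u /\ derivable ('D_u f) y v) ->
  exists s t, [/\ 0 <= s <= h, 0 <= t <= h &
    f (x + h *: u + h *: v) - f (x + h *: u) - (f (x + h *: v) - f x) =
    h * (h * 'D_v ('D_u f) (x + s *: u + t *: v))].
Proof.
move=> h0 df; pose g y := f (y + h *: v) - f y.
have hh : 0 <= h <= h by rewrite h0 lexx.
have h00 : 0 <= (0 : R) <= h by rewrite lexx.
have shiftE y : (fun k : R => k^-1 *: (((fun z => f (z + h *: v)) \o shift y)
    (k *: u) - f (y + h *: v))) =
    (fun k => k^-1 *: ((f \o shift (y + h *: v)) (k *: u) - f (y + h *: v))).
  by apply/funext => k /=; rewrite addrA.
have dg s : 0 <= s <= h -> is_derive (x + s *: u) u g
    ('D_u f (x + s *: u + h *: v) - 'D_u f (x + s *: u)).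
  move=> hs; apply: is_deriveB; last first.
    by apply: derivableP; have [] := df s 0 hs h00; rewrite scale0r addr0.
  by have [d1 _] := df s h hs hh; split; rewrite /derivable /derive shiftE.
have [|s hs] := derivable_MVT g x u h h0.
  by move=> s hs; have [] := dg s hs.
have [_ ->] := dg s hs.
have [|t ht ->] := derivable_MVT ('D_u f) (x + s *: u) v h h0.
  by move=> t ht; have [] := df s t hs ht.
by move=> E; exists s, t; split=> //; rewrite -E /g.
Qed.

Lemma derive_comm f u v x (O : set V) : open O -> O x ->
  (forall y, O y -> [/\ derivable f y u, derivable f y v,
    derivable ('D_u f) y v & derivable ('D_v f) y u]) ->
  {for x, continuous ('D_v ('D_u f))} -> {for x, continuous ('D_u ('D_v f))} ->
  'D_v ('D_u f) x = 'D_u ('D_v f) x.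
Proof.
move=> oO Ox df cvu cuv; apply/eqP; rewrite -subr_eq0; apply/eqP.
apply/normr0_eq0/eqP; rewrite eq_le normr_ge0 andbT; apply/ler_addgt0Pr => e e0.
rewrite add0r.
pose G (st : R * R) : V := x + st.1 *: u + st.2 *: v.
have G00 : G (0, 0) = x by rewrite /G /= !scale0r !addr0.
have cG : {for (0, 0), continuous G}.
  apply: continuousD; first apply: continuousD.
  - exact: cst_continuous.
  - by apply: continuousZr_tmp; exact: cvg_fst.
  - by apply: continuousZr_tmp; exact: cvg_snd.
have e2 : 0 < e / 2 by rewrite divr_gt0.
have near_x : \forall y \near x, [/\ O y,
    `|'D_v ('D_u f) x - 'D_v ('D_u f) y| <= e / 2 &
    `|'D_u ('D_v f) x - 'D_u ('D_v f) y| <= e / 2].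
  have n1 : \forall y \near x, O y by exact: open_nbhs_nbhs.
  have n2 : \forall y \near x, `|'D_v ('D_u f) x - 'D_v ('D_u f) y| <= e / 2.
    by move/cvgrPdist_le: cvu => /(_ _ e2).
  have n3 : \forall y \near x, `|'D_u ('D_v f) x - 'D_u ('D_v f) y| <= e / 2.
    by move/cvgrPdist_le: cuv => /(_ _ e2).
  by apply: filterS3 n1 n2 n3 => y.
have cGx : G @ (0, 0) --> x by rewrite -[X in _ --> X]G00; exact: cG.
have := cGx _ near_x.
move=> [[A B] [/= /nbhs_ballP[r /= r0 Ar] /nbhs_ballP[r' /= r'0 Br']]] AB.
(* Halving makes [h] strictly less than both radii, so the closed parallelogram with sides [h *: u]
   and [h *: v] stays where the estimates hold. *)
pose h := Num.min r r' / 2.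
have m0 : 0 < Num.min r r' by rewrite lt_min r0.
have h0 : 0 < h by rewrite divr_gt0.
have hm : h < Num.min r r' by rewrite ltr_pdivrMr// ltr_pMr// ltr1n.
have hG s t : 0 <= s <= h -> 0 <= t <= h -> [/\ O (G (s, t)),
    `|'D_v ('D_u f) x - 'D_v ('D_u f) (G (s, t))| <= e / 2 &
    `|'D_u ('D_v f) x - 'D_u ('D_v f) (G (s, t))| <= e / 2].
  move=> /andP[s0 sh] /andP[t0 th]; apply: AB; split=> /=.
  - apply: Ar; rewrite /ball/= sub0r normrN ger0_norm//.
    by apply: le_lt_trans sh (lt_le_trans hm _); rewrite ge_min lexx.
  - apply: Br'; rewrite /ball/= sub0r normrN ger0_norm//.
    by apply: le_lt_trans th (lt_le_trans hm _); rewrite ge_min lexx orbT.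
have [|s [t [hs ht E1]]] := second_difference f x u v h (ltW h0).
  move=> s t hs ht y; have [/df[d1 _ d2 _] _ _] := hG s t hs ht.
  exact: conj d1 d2.
have [|t' [s' [ht' hs' E2]]] := second_difference f x v u h (ltW h0).
  move=> t1 s' ht1 hs' y; have -> : y = G (s', t1) by rewrite /y /G /= addrAC.
  by have [/df[_ d1 _ d2] _ _] := hG s' t1 hs' ht1; exact: conj d1 d2.
(* Both sides, multiplied by the square of [h], are the same second difference. The two points may
   differ, but each value is within [e / 2] of the one at [x]. *)
have E : 'D_v ('D_u f) (G (s, t)) = 'D_u ('D_v f) (G (s', t')).
  have hN0 : h != 0 by rewrite gt_eqF.
  have GE : G (s', t') = x + t' *: v + s' *: u by rewrite /G /= addrAC.
  rewrite GE; apply/(mulfI hN0)/(mulfI hN0).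
  apply: etrans (esym E1) _; apply: etrans _ E2.
  rewrite [x + h *: v + _]addrAC.
  by do 4![move: (f _) => ?]; ring.
have [_ b1 _] := hG s t hs ht; have [_ _ b2] := hG s' t' hs' ht'.
apply: le_trans (ler_distD ('D_v ('D_u f) (G (s, t))) _ _) _.
rewrite [leRHS]splitr; apply: lerD; first exact: b1.
by rewrite E distrC; exact: b2.
Qed.

End Schwarz.

(** * Product rules for pairings and for derivatives along a vector field *)

Section DifferentialCalculus.
Context {R : realType} {N : nat}.
Implicit Types (u v x y : 'rV[R]_N) (O : set 'rV[R]_N).

Lemma near_open {T : topologicalType} (A : set T) (t : T) (P : T -> Prop) :
  open A -> A t -> (forall s, A s -> P s) -> \forall s \near t, P s.
Proof. by move=> oA At AP; apply: filterS AP _; exact: open_nbhs_nbhs. Qed.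

Lemma near_open_continuous {S T : topologicalType} (f g : S -> T) A t :
  open A -> A t -> (forall s, A s -> f s = g s) ->
  {for t, continuous g} -> {for t, continuous f}.
Proof.
move=> oA At fg cg; rewrite /prop_for /continuous_at (fg t At).
by apply: cvg_trans cg; apply: near_eq_cvg; apply: near_open oA At _ => s /fg.
Qed.

Lemma is_derive_coord (f : 'rV[R]_N -> 'rV[R]_N) x u k : derivable f x u ->
  is_derive x u (fun y => f y 0 k) (('D_u f x) 0 k).
Proof.
move=> df; rewrite (derive_mx df) mxE; apply: derivableP.
exact: ((derivable_mxP f x u).1 df 0 k).
Qed.

Lemma is_derive_pairing (f g : 'rV[R]_N -> 'rV[R]_N) x u :
  derivable f x u -> derivable g x u ->
  is_derive x u (fun y => pairing (f y) (g y))
    (pairing ('D_u f x) (g x) + pairing (f x) ('D_u g x)).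
Proof.
move=> df dg.
have E : (fun y => pairing (f y) (g y)) =
    \sum_k ((fun y => g y 0 k) * (fun y => f y 0 k)).
  by apply/funext => y; rewrite fct_sumE pairingE.
have H k : is_derive x u ((fun y => g y 0 k) * (fun y => f y 0 k))
    (g x 0 k * ('D_u f x) 0 k + f x 0 k * ('D_u g x) 0 k).
  by apply: is_deriveM; exact: is_derive_coord.
have S := is_derive_sum H.
rewrite E; congr is_derive: S.
rewrite !pairingE -big_split; apply: eq_bigr => k _ /=.
by rewrite [f x 0 k * _]mulrC.
Qed.

Lemma pairingBl u v x : pairing (u - v) x = pairing u x - pairing v x.
Proof. by rewrite ![pairing _ x]pairingC pairingDr pairingNr. Qed.

Lemma derive_dirB {W : normedModType R} (f : 'rV[R]_N -> W) x u v :
  differentiable f x -> 'D_(u - v) f x = 'D_u f x - 'D_v f x.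
Proof. by move=> df; rewrite !deriveE// linearB. Qed.

Lemma derive_basis {W : normedModType R} (f : 'rV[R]_N -> W) x u :
  differentiable f x ->
  'D_u f x = \sum_k u 0 k *: 'D_(delta_mx 0 k) f x.
Proof.
move=> df; rewrite deriveE// [in LHS](row_sum_delta u) linear_sum.
by apply: eq_bigr => k _; rewrite linearZ deriveE.
Qed.

Lemma near_open_derive {W : normedModType R} (f g : 'rV[R]_N -> W) O x u :
  open O -> O x -> (forall y, O y -> f y = g y) -> 'D_u f x = 'D_u g x.
Proof. by move=> oO Ox fg; apply: near_eq_derive; exact: near_open fg. Qed.

Lemma derive_pairingl (f : 'rV[R]_N -> 'rV[R]_N) x u c : derivable f x u ->
  is_derive x u (fun y => pairing (f y) c) (pairing ('D_u f x) c).
Proof.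
move=> df; have := is_derive_pairing f (cst c) x u df (derivable_cst c x u).
have -> : pairing (f x) ('D_u (cst c) x) = 0.
  by rewrite derive_cst /pairing mul0mx mxE.
by rewrite addr0.
Qed.

Lemma derive_comm_row (f : 'rV[R]_N -> 'rV[R]_N) x u v O : open O -> O x ->
  Ck_on 2 O f -> 'D_u ('D_v f) x = 'D_v ('D_u f) x.
Proof.
move=> oO Ox [df d2f].
have dv y w : O y -> derivable f y w by move=> /df; exact: diff_derivable.
have d2v y w w' : O y -> derivable ('D_w f) y w'.
  by move=> Oy; have [+ _] := d2f w => /(_ y Oy); exact: diff_derivable.
have c2 w w' : {for x, continuous ('D_w' ('D_w f))}.
  by have [_ /(_ w' x Ox)] := d2f w.
apply/rowP => k; pose F y := f y 0 k.
have DF w y : O y -> 'D_w F y = 'D_w f y 0 k.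
  by move=> Oy; have [_ ->] := is_derive_coord f y w k (dv y w Oy).
have dDF w w' y : O y -> is_derive y w' ('D_w F) ('D_w' ('D_w f) y 0 k).
  move=> Oy; have D := is_derive_coord ('D_w f) y w' k (d2v y w w' Oy).
  apply: near_eq_is_derive D; apply: near_open oO Oy _ => z Oz; exact/esym/DF.
have cDF w w' : {for x, continuous ('D_w' ('D_w F))}.
  apply: (near_open_continuous _ (fun y => 'D_w' ('D_w f) y 0 k) O x oO Ox).
    by move=> y Oy; have [] := dDF w w' y Oy.
  apply: (@continuous_comp _ _ _ ('D_w' ('D_w f)) (fun A : 'rV[R]_N => A 0 k)).
    exact: c2.
  exact: coord_continuous.
have := derive_comm F v u x O oO Ox _ (cDF v u) (cDF u v).
have [_ ->] := dDF v u x Ox; have [_ ->] := dDF u v x Ox; apply=> y Oy.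
have [d1 _] := is_derive_coord f y u k (dv y u Oy).
have [d2 _] := is_derive_coord f y v k (dv y v Oy).
have [d3 _] := dDF v u y Oy; have [d4 _] := dDF u v y Oy.
exact: And4 d2 d1 d3 d4.
Qed.

(** The direction [z y] moves with the point. Expanding it in the constant basis turns the function
    into a sum of products, to which the Leibniz rule applies. *)
Lemma is_derive_field (f z : 'rV[R]_N -> 'rV[R]_N) x u c O : open O -> O x ->
  Ck_on 2 O f -> derivable z x u ->
  is_derive x u (fun y => pairing ('D_(z y) f y) c)
    (pairing ('D_('D_u z x) f x) c + pairing ('D_u ('D_(z x) f) x) c).
Proof.
move=> oO Ox [df d2f] dz.
have d2v w w' : derivable ('D_w f) x w'.
  by have [+ _] := d2f w => /(_ x Ox); exact: diff_derivable.
pose e k : 'rV[R]_N := delta_mx 0 k.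
have E y : O y -> \sum_k z y 0 k * pairing ('D_(e k) f y) c =
    pairing ('D_(z y) f y) c.
  move=> Oy; rewrite [in RHS](derive_basis f y _ (df y Oy)) [RHS]pairingC.
  rewrite pairing_sum.
  by apply: eq_bigr => k _; rewrite pairingZr pairingC.
have H k : is_derive x u
    ((fun y => z y 0 k) * (fun y => pairing ('D_(e k) f y) c))
    (z x 0 k * pairing ('D_u ('D_(e k) f) x) c +
     pairing ('D_(e k) f x) c * ('D_u z x) 0 k).
  apply: is_deriveM; first exact: is_derive_coord.
  exact: derive_pairingl (d2v _ _).
have S := is_derive_sum H; rewrite big_split /= addrC in S.
apply: (near_eq_is_derive (f := \sum_k
    ((fun y => z y 0 k) * (fun y => pairing ('D_(e k) f y) c)))).
  by apply: near_open oO Ox _ => y Oy; rewrite -E// fct_sumE.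
congr is_derive: S; congr (_ + _).
  rewrite [in RHS](derive_basis f x _ (df x Ox)) [RHS]pairingC pairing_sum.
  by apply: eq_bigr => k _; rewrite pairingZr pairingC mulrC.
have -> : 'D_u ('D_(z x) f) x = \sum_k z x 0 k *: 'D_u ('D_(e k) f) x.
  have K k : is_derive x u (z x 0 k *: 'D_(e k) f)
      (z x 0 k *: 'D_u ('D_(e k) f) x).
    by apply: is_deriveZ; exact: derivableP (d2v _ _).
  have [_ <-] := is_derive_sum K.
  apply: near_open_derive oO Ox _ => y Oy.
  by rewrite (derive_basis f y _ (df y Oy)) fct_sumE.
rewrite [RHS]pairingC pairing_sum; apply: eq_bigr => k _.
by rewrite pairingZr pairingC.
Qed.

End DifferentialCalculus.

(** * The bracket of two null fields, as algebra of jets at a point *)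

(* Df u v and Hf u v y stand for the values at y of the first and second
   derivatives, along u and along v then u, of a 1-form f; then Drho_form is
   the derivative of rho_form along u, its arguments z and v being fixed. *)
Section NullBracket.
Context {K : comPzRingType} {L : zmodType}.
Implicit Types (f : L -> K) (Df : L -> L -> K) (Hf : L -> L -> L -> K).
Implicit Types (u v x y z t : L).

Definition dform Df u v := Df u v - Df v u.

Definition rho_form Df g h u v := dform Df u v + 2 * (g u * h v - h u * g v).

Definition Drho_form Hf g Dg h Dh u z v := Hf u z v - Hf u v z +
  2 * (Dg u z * h v + g z * Dh u v - (Dh u z * g v + h z * Dg u v)).

(** The cyclic sum is the exterior derivative evaluated on constant fields. Symmetry of [Hf] is ddf
    = 0, which leaves 2 (dg /\ h - g /\ dh). *)
Let cyclic_Drho Hf g Dg h Dh z t v : (forall u y w, Hf u y w = Hf y u w) ->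
  Drho_form Hf g Dg h Dh z t v - Drho_form Hf g Dg h Dh t z v +
    Drho_form Hf g Dg h Dh v z t =
  2 * (dform Dg z t * h v - dform Dg z v * h t + dform Dg t v * h z -
    (dform Dh z t * g v - dform Dh z v * g t + dform Dh t v * g z)).
Proof.
move=> Hsym; rewrite /Drho_form /dform (Hsym z t) (Hsym v z) (Hsym v t); ring.
Qed.

Variables (al be ga : L -> K) (Dal Dbe Dga : L -> L -> K).
Variables (Hb Hg : L -> L -> L -> K) (z1 z2 t1 t2 : L) (Z1 Z2 T1 T2 : L -> L).

Local Notation Pb := (rho_form Dbe ga al).
Local Notation Pg := (rho_form Dga al be).
Local Notation DPb := (Drho_form Hb ga Dga al Dal).
Local Notation DPg := (Drho_form Hg al Dal be Dbe).

Hypotheses (al_B : {morph al : x y / x - y}) (be_B : {morph be : x y / x - y}).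
Hypotheses (ga_B : {morph ga : x y / x - y}).
Hypothesis Dbe_Bl : forall v, {morph Dbe^~ v : x y / x - y}.
Hypothesis Dga_Bl : forall v, {morph Dga^~ v : x y / x - y}.
Hypothesis Dbe_Br : forall v, {morph Dbe v : x y / x - y}.
Hypothesis Dga_Br : forall v, {morph Dga v : x y / x - y}.
Hypothesis Hb_sym : forall u y w, Hb u y w = Hb y u w.
Hypothesis Hg_sym : forall u y w, Hg u y w = Hg y u w.

(** With [al], [be], [ga] in the roles of w_a, w_b, w_c, these are the real and imaginary parts of
    w_a(z) = 0, theta(z) = 0 and P(z, v) = 0 for z = x + iy. *)
Definition null_system (x y : L) :=
  [/\ al x = 0, al y = 0, be x = - ga y & be y = ga x] /\
  forall v, Pb x v + Pg y v = 0 /\ Pb y v - Pg x v = 0.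

(** The null system differentiated along [u], for a field with value [(x, y)] and derivative
    [(X u, Y u)]; the test vector [v] is held constant. *)
Definition derived_null_system (x y : L) (X Y : L -> L) := forall u,
  [/\ Dal u x + al (X u) = 0, Dal u y + al (Y u) = 0,
      Dbe u x + be (X u) = - (Dga u y + ga (Y u)) &
      Dbe u y + be (Y u) = Dga u x + ga (X u)] /\
  forall v,
  Pb (X u) v + DPb u x v + (Pg (Y u) v + DPg u y v) = 0 /\
  Pb (Y u) v + DPb u y v - (Pg (X u) v + DPg u x v) = 0.

Hypotheses (z_null : null_system z1 z2) (t_null : null_system t1 t2).
Hypothesis Dz_null : derived_null_system z1 z2 Z1 Z2.
Hypothesis Dt_null : derived_null_system t1 t2 T1 T2.
Hypothesis levi1 : dform Dal z1 t1 = dform Dal z2 t2.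
Hypothesis levi2 : dform Dal z1 t2 = - dform Dal z2 t1.

Let PB Df g h : {morph g : x y / x - y} -> {morph h : x y / x - y} ->
  (forall v, {morph Df^~ v : x y / x - y}) ->
  (forall v, {morph Df v : x y / x - y}) ->
  forall v, {morph (rho_form Df g h)^~ v : x y / x - y}.
Proof.
by move=> gB hB Dl Dr v x y; rewrite /rho_form /dform gB hB Dl Dr; ring.
Qed.

Let PbB := PB Dbe ga al ga_B al_B Dbe_Bl Dbe_Br.
Let PgB := PB Dga al be al_B be_B Dga_Bl Dga_Br.

Let P_skew Df g h u v : rho_form Df g h u v = - rho_form Df g h v u.
Proof. rewrite /rho_form /dform; ring. Qed.

(** Real and imaginary parts of D_z t - D_t z. Only differences are used, since additivity of the
    forms is assumed as compatibility with subtraction. *)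
Let b1 := T1 z1 - Z1 t1 - (T2 z2 - Z2 t2).
Let b2 := T2 z1 - Z1 t2 - (Z2 t1 - T1 z2).

Let dbe_dga x y : al x = 0 -> al y = 0 ->
  Pb x y = dform Dbe x y /\ Pg x y = dform Dga x y.
Proof. by move=> hx hy; split; rewrite /rho_form hx hy; ring. Qed.

(** P and d theta agree on the kernel of [al], so d theta vanishes on z paired with [t1] and with
    [t2]; each of these gives a real and an imaginary part. *)
Let dtheta : [/\ dform Dbe z1 t1 + dform Dga z2 t1 = 0,
  dform Dbe z2 t1 - dform Dga z1 t1 = 0,
  dform Dbe z1 t2 + dform Dga z2 t2 = 0 &
  dform Dbe z2 t2 - dform Dga z1 t2 = 0].
Proof.
have [[za1 za2 _ _] hz] := z_null; have [[ta1 ta2 _ _] _] := t_null.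
have [<- <-] := dbe_dga _ _ za1 ta1; have [<- <-] := dbe_dga _ _ za2 ta1.
have [<- <-] := dbe_dga _ _ za1 ta2; have [<- <-] := dbe_dga _ _ za2 ta2.
by have [? ?] := hz t1; have [? ?] := hz t2.
Qed.

(* D_v is applied to the equations of z and the result is evaluated on t. *)
Let DPv v : DPb v z1 t1 + DPg v z2 t1 - DPb v z2 t2 + DPg v z1 t2 = 0 /\
  DPb v z2 t1 - DPg v z1 t1 + DPb v z1 t2 + DPg v z2 t2 = 0.
Proof.
have [_ hz] := Dz_null v; have [_ ht] := t_null.
have [e1 f1] := hz t1; have [e2 f2] := hz t2.
(* The terms P(D_v z, t) vanish by skewness, because t is a null vector too; only the derivative of
   the coefficients of P remains. *)
have [k1 l1] := ht (Z1 v); have [k2 l2] := ht (Z2 v).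
split.
  transitivity ((Pb (Z1 v) t1 + DPb v z1 t1 + (Pg (Z2 v) t1 + DPg v z2 t1)) -
    (Pb (Z2 v) t2 + DPb v z2 t2 - (Pg (Z1 v) t2 + DPg v z1 t2)) +
    (Pb t1 (Z1 v) + Pg t2 (Z1 v)) - (Pb t2 (Z2 v) - Pg t1 (Z2 v))).
    rewrite /rho_form /dform; ring.
  by rewrite e1 f2 k1 l2 !subr0 add0r.
transitivity ((Pb (Z2 v) t1 + DPb v z2 t1 - (Pg (Z1 v) t1 + DPg v z1 t1)) +
  (Pb (Z1 v) t2 + DPb v z1 t2 + (Pg (Z2 v) t2 + DPg v z2 t2)) +
  (Pb t1 (Z2 v) + Pg t2 (Z2 v)) + (Pb t2 (Z1 v) - Pg t1 (Z1 v))).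
  rewrite /rho_form /dform; ring.
by rewrite f1 e2 k2 l1 !addr0.
Qed.

Let cycb z t v := DPb z t v - DPb t z v + DPb v z t.
Let cycg z t v := DPg z t v - DPg t z v + DPg v z t.

(* dP = 2i (dtheta /\ al - theta /\ dal) with theta = be - i ga *)
Let cyc0 v : cycb z1 t1 v - cycb z2 t2 v + (cycg z1 t2 v + cycg z2 t1 v) = 0 /\
  cycb z2 t1 v + cycb z1 t2 v + (cycg z2 t2 v - cycg z1 t1 v) = 0.
Proof.
have [[za1 za2 zb1 zb2] _] := z_null; have [[ta1 ta2 tb1 tb2] _] := t_null.
have [/eqP d1 /eqP d2 /eqP d3 /eqP d4] := dtheta.
move: d1 d2 d3 d4; rewrite !addr_eq0 !opprK => /eqP d1 /eqP d2 /eqP d3 /eqP d4.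
rewrite /cycb /cycg !cyclic_Drho// za1 za2 zb1 zb2 ta1 ta2 tb1 tb2.
rewrite levi1 levi2 d1 d2 d3 d4.
split; ring.
Qed.

(** Each equation for the bracket is the equation of t differentiated along z, minus that of z
    differentiated along t, minus an exterior derivative on (z, t): d w_a or d theta for the
    1-forms. For P it is the cyclic sum, whose third term, the derivative along [v], has to be added
    back and vanishes by [DPv]. The intermediate expressions below are these combinations. *)
Lemma null_system_bracket : null_system b1 b2.
Proof.
split.
  have [[a1 a2 a3 a4] _] := Dz_null t1; have [[a5 a6 a7 a8] _] := Dz_null t2.
  have [[c1 c2 c3 c4] _] := Dt_null z1; have [[c5 c6 c7 c8] _] := Dt_null z2.
  have [d1 d2 d3 d4] := dtheta.
  rewrite /b1 /b2 !al_B !be_B !ga_B; split.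
  - transitivity ((Dal z1 t1 + al (T1 z1)) - (Dal t1 z1 + al (Z1 t1)) -
      ((Dal z2 t2 + al (T2 z2)) - (Dal t2 z2 + al (Z2 t2))) -
      (dform Dal z1 t1 - dform Dal z2 t2)); first by rewrite /dform; ring.
    by rewrite c1 a1 c6 a6 levi1 !(subrr, subr0).
  - transitivity ((Dal z1 t2 + al (T2 z1)) - (Dal t1 z2 + al (Z2 t1)) -
      ((Dal t2 z1 + al (Z1 t2)) - (Dal z2 t1 + al (T1 z2))) -
      (dform Dal z1 t2 + dform Dal z2 t1)); first by rewrite /dform; ring.
    by rewrite c2 a2 a5 c5 levi2 !(addNr, subr0).
  - apply/eqP; rewrite -addr_eq0; apply/eqP.
    transitivity ((Dbe z1 t1 + be (T1 z1) + (Dga z1 t2 + ga (T2 z1))) -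
      (Dbe t1 z1 + be (Z1 t1) + (Dga t1 z2 + ga (Z2 t1))) -
      (Dbe z2 t2 + be (T2 z2) - (Dga z2 t1 + ga (T1 z2))) +
      (Dbe t2 z2 + be (Z2 t2) - (Dga t2 z1 + ga (Z1 t2))) -
      (dform Dbe z1 t1 + dform Dga z2 t1) +
      (dform Dbe z2 t2 - dform Dga z1 t2)).
      by rewrite /dform; ring.
    by rewrite c3 a3 c8 a8 d1 d4 !(subrr, addNr, subr0, addr0).
  - apply/eqP; rewrite -subr_eq0; apply/eqP.
    transitivity ((Dbe z1 t2 + be (T2 z1) - (Dga z1 t1 + ga (T1 z1))) -
      (Dbe t1 z2 + be (Z2 t1) - (Dga t1 z1 + ga (Z1 t1))) -
      (Dbe t2 z1 + be (Z1 t2) + (Dga t2 z2 + ga (Z2 t2))) +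
      (Dbe z2 t1 + be (T1 z2) + (Dga z2 t2 + ga (T2 z2))) -
      (dform Dbe z2 t1 - dform Dga z1 t1) -
      (dform Dbe z1 t2 + dform Dga z2 t2)).
      by rewrite /dform; ring.
    by rewrite c4 a4 c7 a7 d2 d3 !(subrr, addNr, subr0, addr0).
move=> v; have [N1 N2] := DPv v; have [C1 C2] := cyc0 v.
have [_ /(_ v)[a1 a2]] := Dz_null t1; have [_ /(_ v)[a3 a4]] := Dz_null t2.
have [_ /(_ v)[c1 c2]] := Dt_null z1; have [_ /(_ v)[c3 c4]] := Dt_null z2.
rewrite /b1 /b2 !PbB !PgB; split.
  transitivity ((Pb (T1 z1) v + DPb z1 t1 v + (Pg (T2 z1) v + DPg z1 t2 v)) -
    (Pb (T2 z2) v + DPb z2 t2 v - (Pg (T1 z2) v + DPg z2 t1 v)) -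
    (Pb (Z1 t1) v + DPb t1 z1 v + (Pg (Z2 t1) v + DPg t1 z2 v)) +
    (Pb (Z2 t2) v + DPb t2 z2 v - (Pg (Z1 t2) v + DPg t2 z1 v)) -
    (cycb z1 t1 v - cycb z2 t2 v + (cycg z1 t2 v + cycg z2 t1 v)) +
    (DPb v z1 t1 + DPg v z2 t1 - DPb v z2 t2 + DPg v z1 t2)).
    by rewrite /cycb /cycg; ring.
  by rewrite c1 c4 a1 a4 N1 C1 !(subr0, addr0).
transitivity ((Pb (T1 z2) v + DPb z2 t1 v + (Pg (T2 z2) v + DPg z2 t2 v)) +
  (Pb (T2 z1) v + DPb z1 t2 v - (Pg (T1 z1) v + DPg z1 t1 v)) -
  (Pb (Z1 t2) v + DPb t2 z1 v + (Pg (Z2 t2) v + DPg t2 z2 v)) -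
  (Pb (Z2 t1) v + DPb t1 z2 v - (Pg (Z1 t1) v + DPg t1 z1 v)) -
  (cycb z2 t1 v + cycb z1 t2 v + (cycg z2 t2 v - cycg z1 t1 v)) +
  (DPb v z2 t1 - DPg v z1 t1 + DPb v z1 t2 + DPg v z2 t2)).
  by rewrite /cycb /cycg; ring.
by rewrite c2 c3 a2 a3 N2 C2 !(subr0, addr0).
Qed.

End NullBracket.

(** * The bracket of null fields on an open set of coordinate space *)

Section CoordinateBracket.
Context {R : realType} {N : nat}.
Implicit Types (u v x y : 'rV[R]_N) (O : set 'rV[R]_N).

Definition jet (f : 'rV[R]_N -> 'rV[R]_N) x u v := pairing ('D_u f x) v.

Definition jet2 (f : 'rV[R]_N -> 'rV[R]_N) x u v y :=
  pairing ('D_u ('D_v f) x) y.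

Lemma is_derive_rho_form (f g h z : 'rV[R]_N -> 'rV[R]_N) O x u v :
  open O -> O x -> Ck_on 2 O f -> derivable g x u -> derivable h x u ->
  derivable z x u ->
  is_derive x u
    (fun y => rho_form (jet f y) (pairing (g y)) (pairing (h y)) (z y) v)
    (rho_form (jet f x) (pairing (g x)) (pairing (h x)) ('D_u z x) v +
     Drho_form (jet2 f x) (pairing (g x)) (jet g x) (pairing (h x)) (jet h x)
       u (z x) v).
Proof.
move=> oO Ox f2 dg dh dz.
have dvf : derivable ('D_v f) x u.
  by have [_ /(_ v)[/(_ x Ox) + _]] := f2; exact: diff_derivable.
have D1 := is_derive_field f z x u v O oO Ox f2 dz.
have D2 := is_derive_pairing ('D_v f) z x u dvf dz.
have D3 := is_deriveM (is_derive_pairing g z x u dg dz)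
  (derive_pairingl h x u v dh).
have D4 := is_deriveM (is_derive_pairing h z x u dh dz)
  (derive_pairingl g x u v dg).
have D := is_deriveD (is_deriveB D1 D2) (is_deriveZ 2 (is_deriveB D3 D4)).
have E (a b c d gz dhv hv dgz gdz hz dgv gv dhz hdz : R) :
    a + b - (c + d) + 2 * (gz * dhv + hv * (dgz + gdz) -
      (hz * dgv + gv * (dhz + hdz))) =
    a - d + 2 * (gdz * hv - hdz * gv) +
    (b - c + 2 * (dgz * hv + gz * dhv - (dhz * gv + hz * dgv))).
  by ring.
congr is_derive: D; exact: E.
Qed.

Lemma derive_open0 (f : 'rV[R]_N -> R) O x u (d : R) : open O -> O x ->
  is_derive x u f d -> (forall y, O y -> f y = 0) -> d = 0.
Proof.
move=> oO Ox [_ <-] f0; rewrite (near_open_derive f (cst 0) O x u oO Ox f0).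
exact: derive_cst.
Qed.

(** The null equations hold on the whole open set [O], so their left sides have zero derivative at
    [x]. *)
Lemma derive_null_system (A B C z1 z2 : 'rV[R]_N -> 'rV[R]_N) O x :
  open O -> O x -> Ck_on 2 O A -> Ck_on 2 O B -> Ck_on 2 O C ->
  (forall u, derivable z1 x u) -> (forall u, derivable z2 x u) ->
  (forall y, O y -> null_system (pairing (A y)) (pairing (B y)) (pairing (C y))
    (jet B y) (jet C y) (z1 y) (z2 y)) ->
  derived_null_system (pairing (A x)) (pairing (B x)) (pairing (C x))
    (jet A x) (jet B x) (jet C x) (jet2 B x) (jet2 C x) (z1 x) (z2 x)
    (fun u => 'D_u z1 x) (fun u => 'D_u z2 x).
Proof.
move=> oO Ox A2 B2 C2 dz1 dz2 nullz u.
have dd (f : 'rV[R]_N -> 'rV[R]_N) : Ck_on 2 O f -> derivable f x u.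
  by move=> [/(_ x Ox) + _]; exact: diff_derivable.
have dA := dd A A2; have dB := dd B B2; have dC := dd C C2.
have pd f z df dz := is_derive_pairing f z x u df dz.
have pA1 := pd A z1 dA (dz1 u); have pA2 := pd A z2 dA (dz2 u).
have pB1 := pd B z1 dB (dz1 u); have pB2 := pd B z2 dB (dz2 u).
have pC1 := pd C z1 dC (dz1 u); have pC2 := pd C z2 dC (dz2 u).
split.
  split.
  - by apply: derive_open0 oO Ox pA1 _ => y /nullz[[]].
  - by apply: derive_open0 oO Ox pA2 _ => y /nullz[[]].
  - apply/eqP; rewrite -addr_eq0; apply/eqP.
    apply: derive_open0 oO Ox (is_deriveD pB1 pC2) _ => y /nullz[[_ _ e _] _].
    apply: (etrans (congr1 (fun r => r + _) e)); exact: addNr.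
  - apply/eqP; rewrite -subr_eq0; apply/eqP.
    apply: derive_open0 oO Ox (is_deriveB pB2 pC1) _ => y /nullz[[_ _ _ e] _].
    apply: (etrans (congr1 (fun r => r - _) e)); exact: subrr.
move=> v.
have rB z dz := is_derive_rho_form B C A z O x u v oO Ox B2 dC dA dz.
have rC z dz := is_derive_rho_form C A B z O x u v oO Ox C2 dA dB dz.
have rB1 := rB z1 (dz1 u); have rB2 := rB z2 (dz2 u).
have rC1 := rC z1 (dz1 u); have rC2 := rC z2 (dz2 u).
split.
  by apply: derive_open0 oO Ox (is_deriveD rB1 rC2) _ => y /nullz[_ /(_ v)[]].
by apply: derive_open0 oO Ox (is_deriveB rB2 rC1) _ => y /nullz[_ /(_ v)[]].
Qed.

Lemma null_system_lie (A B C z1 z2 t1 t2 : 'rV[R]_N -> 'rV[R]_N) O x :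
  open O -> O x -> Ck_on 2 O A -> Ck_on 2 O B -> Ck_on 2 O C ->
  (forall u, derivable z1 x u) -> (forall u, derivable z2 x u) ->
  (forall u, derivable t1 x u) -> (forall u, derivable t2 x u) ->
  (forall y, O y -> null_system (pairing (A y)) (pairing (B y)) (pairing (C y))
    (jet B y) (jet C y) (z1 y) (z2 y)) ->
  (forall y, O y -> null_system (pairing (A y)) (pairing (B y)) (pairing (C y))
    (jet B y) (jet C y) (t1 y) (t2 y)) ->
  dform (jet A x) (z1 x) (t1 x) = dform (jet A x) (z2 x) (t2 x) ->
  dform (jet A x) (z1 x) (t2 x) = - dform (jet A x) (z2 x) (t1 x) ->
  null_system (pairing (A x)) (pairing (B x)) (pairing (C x))
    (jet B x) (jet C x)
    ('D_(z1 x) t1 x - 'D_(t1 x) z1 x - ('D_(z2 x) t2 x - 'D_(t2 x) z2 x))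
    ('D_(z1 x) t2 x - 'D_(t2 x) z1 x + ('D_(z2 x) t1 x - 'D_(t1 x) z2 x)).
Proof.
move=> oO Ox A2 B2 C2 dz1 dz2 dt1 dt2 nz nt l1 l2.
have Dz := derive_null_system A B C z1 z2 O x oO Ox A2 B2 C2 dz1 dz2 nz.
have Dt := derive_null_system A B C t1 t2 O x oO Ox A2 B2 C2 dt1 dt2 nt.
have pB f : {morph pairing (f : 'rV[R]_N) : y z / y - z}.
  by move=> y z; rewrite pairingDr pairingNr.
have jBl (f : 'rV[R]_N -> 'rV[R]_N) : Ck_on 2 O f ->
    forall v, {morph (jet f x)^~ v : y z / y - z}.
  move=> [/(_ x Ox) df _] v y z.
  exact: etrans (congr1 (fun a => pairing a v) (derive_dirB f x y z df))
    (pairingBl _ _ _).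
have jBr f v : {morph jet f x v : y z / y - z} by exact: pB.
have js (f : 'rV[R]_N -> 'rV[R]_N) : Ck_on 2 O f ->
    forall u y w, jet2 f x u y w = jet2 f x y u w.
  move=> f2 u y w.
  by rewrite /jet2 (derive_comm_row f x u y O oO Ox f2).
have subE (V : zmodType) (a b c : V) : a + (b - c) = a - (c - b).
  by rewrite opprB.
rewrite [X in null_system _ _ _ _ _ _ X]subE.
exact: (null_system_bracket (pairing (A x)) (pairing (B x)) (pairing (C x))
  (jet A x) (jet B x) (jet C x) (jet2 B x) (jet2 C x) (z1 x) (z2 x) (t1 x)
  (t2 x) (fun u => 'D_u z1 x) (fun u => 'D_u z2 x) (fun u => 'D_u t1 x)
  (fun u => 'D_u t2 x) (pB _) (pB _) (pB _) (jBl B B2) (jBl C C2) (jBr B)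
  (jBr C) (js B B2) (js C C2) (nz x Ox) (nt x Ox) Dz Dt l1 l2).
Qed.

End CoordinateBracket.

(** * Passage from the manifold to a chart *)

Section Charts.
Context {R : realType} {N : nat} {M : smooth_manifold R N}.
Implicit Types (i : mfd_chart M) (p : M) (u v : 'rV[R]_N) (O : set M).

Lemma Ck_on_subset {W : normedModType R} k (A B : set 'rV[R]_N)
  (f : 'rV[R]_N -> W) : B `<=` A -> Ck_on k A f -> Ck_on k B f.
Proof.
move=> BA; elim: k f => [|k IH] f /=; first by move=> cf x /BA /cf.
by move=> [df dvf]; split=> [x /BA /df //|v]; exact: IH (dvf v).
Qed.

Lemma Ck_differentiable {W : normedModType R} k (A : set 'rV[R]_N)
  (f : 'rV[R]_N -> W) x : Ck_on k.+1 A f -> A x -> differentiable f x.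
Proof. by move=> [df _] /df. Qed.

(** Inside the open image of the chart, this set is the preimage of [O] under the continuous inverse
    [mfd_psi i]. *)
Lemma open_chart_image O i : open O -> open (mfd_phi i @` (O `&` mfd_dom i)).
Proof.
move=> oO; rewrite openE => _ [p [Op ip] <-].
have im_p : (mfd_phi i @` mfd_dom i) (mfd_phi i p) by exists p.
have cpsi : {for mfd_phi i p, continuous (mfd_psi i)}.
  have := mfd_psi_cont (s := M) (i := i).
  rewrite (continuous_open_subspace _ (@mfd_im_open _ _ M i)); apply.
  exact: mem_set.
have nO : \forall y \near mfd_phi i p, O (mfd_psi i y).
  by apply: cpsi; rewrite mfd_phiK//; exact: open_nbhs_nbhs.
have nA := open_nbhs_nbhs (conj (@mfd_im_open _ _ M i) im_p).
apply: filterS2 nO nA => y Oy [q iq qy]; exists q => //; split=> //.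
by rewrite -(mfd_phiK (i := i) iq) qy.
Qed.

(** [ext_deriv] is built from partial derivatives; differentiability makes the directional
    derivative linear in its direction, so they determine it. *)
Lemma bil_ext_deriv (w : components M) i p u v :
  differentiable (w i \o mfd_psi i) (mfd_phi i p) ->
  bil (ext_deriv w i p) u v =
  dform (jet (w i \o mfd_psi i) (mfd_phi i p)) u v.
Proof.
set f := _ \o _ => df.
pose B : 'M[R]_N := \matrix_(k, l) 'D_(delta_mx 0 k) f (mfd_phi i p) 0 l.
have jetE x y : jet f (mfd_phi i p) x y = bil B x y.
  rewrite /jet pairingC /pairing /bil; congr ((_ *m _) 0 0).
  rewrite (derive_basis f _ x df); apply/rowP => l.
  by rewrite summxE !mxE; apply: eq_bigr => k _; rewrite !mxE.
have -> : ext_deriv w i p = B + (-1) *: B^T.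
  by apply/matrixP => k l; rewrite !mxE mulN1r.
by rewrite /dform !jetE bilDm bilZm mulN1r -bil_tr.
Qed.

Lemma bil_rho_form (w : 'I_3 -> components M) a i p u v :
  differentiable (w a i \o mfd_psi i) (mfd_phi i p) ->
  bil (rho w a i p) u v = rho_form (jet (w a i \o mfd_psi i) (mfd_phi i p))
    (pairing (w (a + 1) i p)) (pairing (w (a + 2) i p)) u v.
Proof. by move=> df; rewrite bil_rho bil_ext_deriv. Qed.

Lemma null_system_rho (w : 'I_3 -> components M) a i p (x y : 'rV[R]_N) :
  mfd_dom i p ->
  (forall b, differentiable (w b i \o mfd_psi i) (mfd_phi i p)) ->
  let W b := w b i \o mfd_psi i in let q := mfd_phi i p in
  null_system (pairing (W a q)) (pairing (W (a + 1) q)) (pairing (W (a + 2) q))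
    (jet (W (a + 1)) q) (jet (W (a + 2)) q) x y <->
  [/\ pairing (w a i p) x = 0, pairing (w a i p) y = 0,
    pairing (w (a + 1) i p) x = - pairing (w (a + 2) i p) y &
    pairing (w (a + 1) i p) y = pairing (w (a + 2) i p) x] /\
  forall v,
    bil (rho w (a + 1) i p) x v + bil (rho w (a + 2) i p) y v = 0 /\
    bil (rho w (a + 1) i p) y v - bil (rho w (a + 2) i p) x v = 0.
Proof.
move=> ip dw W q.
have WE b : W b q = w b i p by rewrite /W /= mfd_phiK.
have rhoE1 u v := bil_rho_form w (a + 1) i p u v (dw (a + 1)).
have rhoE2 u v := bil_rho_form w (a + 2) i p u v (dw (a + 2)).
(* [rho w (a + 1)] involves the wedge of the forms of index [a + 2] and [a], and [rho w (a + 2)]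
   that of index [a] and [a + 1]. *)
rewrite ord3_add11 ord3_add12 in rhoE1; rewrite ord3_add21 ord3_add22 in rhoE2.
rewrite !WE; split=> -[h k]; (split; first exact: h) => v.
  by rewrite !rhoE1 !rhoE2; exact: k.
by have := k v; rewrite !rhoE1 !rhoE2.
Qed.

End Charts.

Theorem theoremA (R : realType) (n : nat)
    (M : smooth_manifold R (4 * n + 3)%N) (U : set M)
    (w : 'I_3 -> components M) (J : 'I_3 -> endo_components M)
    (xi : 'I_3 -> components M) (Jbar : 'I_3 -> endo_components M)
    (hU : open U)
    (hw : nondegenerate_qCR U w J)
    (hxi : dual_frame U w xi)
    (hJbar : extends_J U w J xi Jbar)
    (a : 'I_3) :
  integrable_CR U w Jbar a.
Proof.
move=> O Z T oO OU [Z1 Z2 ZT10] [T1 T2 TT10] i p Op ip.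
pose W d := w d i \o mfd_psi i; pose x := mfd_phi i p.
pose O' := mfd_phi i @` (O `&` mfd_dom i).
have oO' : open O' := open_chart_image O i oO.
have O'x : O' x by exists p.
(* Order two, because [rho] contains first derivatives of [w] and is itself differentiated. *)
have W2 d : Ck_on 2 O' (W d).
  have [/(_ i 2) + _] := qCR_form hw d; apply: Ck_on_subset.
  by move=> _ [q [Oq iq] <-]; exists q => //; split=> //; exact: OU.
have dfield X : vector_field O X -> forall u, derivable (X i \o mfd_psi i) x u.
  move=> [/(_ i 1%N) [/(_ x O'x) dX _] _] u; exact: diff_derivable dX.
(* Both directions serve: one at every point of [O] in the chart, to obtain equations that can be
   differentiated, the other at [p], to recognize the bracket as an eigenvector. *)
have T10E q z : O q -> mfd_dom i q -> T10 w Jbar a i q z <->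
    null_system (pairing (W a (mfd_phi i q)))
      (pairing (W (a + 1) (mfd_phi i q))) (pairing (W (a + 2) (mfd_phi i q)))
      (jet (W (a + 1)) (mfd_phi i q))
      (jet (W (a + 2)) (mfd_phi i q)) z.1 z.2.
  move=> Oq iq; apply: iff_trans (T10P hw hxi hJbar (OU q Oq) iq a z) _.
  have O'q : O' (mfd_phi i q) by exists q.
  apply: iff_sym; apply: null_system_rho iq _ => b.
  exact: Ck_differentiable _ _ _ _ (W2 b) O'q.
have valE (X : components M) q : mfd_dom i q ->
    (X i \o mfd_psi i) (mfd_phi i q) = X i q by move=> iq; rewrite /= mfd_phiK.
have null_section S : (forall q, O q -> mfd_dom i q ->
      T10 w Jbar a i q (cval S i q)) -> forall y, O' y ->
    null_system (pairing (W a y)) (pairing (W (a + 1) y))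
      (pairing (W (a + 2) y)) (jet (W (a + 1)) y) (jet (W (a + 2)) y)
      ((S.1 i \o mfd_psi i) y) ((S.2 i \o mfd_psi i) y).
  move=> hS _ [q [Oq iq] <-]; rewrite !valE//.
  exact: (T10E q _ Oq iq).1 (hS q Oq iq).
have sE u v : bil (ext_deriv (w a) i p) u v = dform (jet (W a) x) u v.
  exact: bil_ext_deriv (Ck_differentiable _ _ _ _ (W2 a) O'x).
have [l1 l2] := sigma_T10 hw hxi hJbar (OU p Op) ip a _ _
  (ZT10 i p Op ip) (TT10 i p Op ip).
rewrite !sE in l1 l2.
apply/(T10E p _ Op ip).
have := null_system_lie (W a) (W (a + 1)) (W (a + 2)) (Z.1 i \o mfd_psi i)
  (Z.2 i \o mfd_psi i) (T.1 i \o mfd_psi i) (T.2 i \o mfd_psi i) O' x oO' O'x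
  (W2 _) (W2 _) (W2 _) (dfield _ Z1) (dfield _ Z2) (dfield _ T1) (dfield _ T2)
  (null_section Z (ZT10 i)) (null_section T (TT10 i)).
rewrite !(valE _ p ip); apply; [exact: l1 | exact: l2].
Qed.
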